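(* Let $F_1,F_2\in C(\mathbb{R}^2\times\mathbb{R})$ be non-negative functions such that $$F_2(x,r_2)\ge F_1(x,r_1)$$ for every $x\in\mathbb{R}^2$ and $r_1,r_2\in\mathbb{R}$ satisfying $r_2\ge r_1$. Assume that $\psi_1,\psi_2\in C^2(\mathbb{R}^2)$ satisfy $$-\Delta\psi_2(x)+F_2(x,\psi_2(x))\le-\Delta\psi_1(x)+F_1(x,\psi_1(x))\quad\text{for every }x\in\mathbb{R}^2,$$ and $$\liminf_{x\to\infty}\frac{\psi_1(x)-\psi_2(x)}{\log|x|}\ge0.$$ Then either $\psi_1\ge\psi_2$ in $\mathbb{R}^2$, or $\psi_2>\psi_1$ in $\mathbb{R}^2$, $\psi_2-\psi_1$ is a constant, and $$F_1(x,\psi_1(x))=F_2(x,\psi_2(x)),\quad x\in\mathbb{R}^2.$$ *)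

(* Defs.v *)
From HB Require Import structures.
From mathcomp Require Import all_boot all_order all_algebra.
From mathcomp Require Import all_classical all_reals all_analysis.

Set Implicit Arguments.
Unset Strict Implicit.
Unset Printing Implicit Defensive.

Import Order.TTheory GRing.Theory Num.Theory.
Import numFieldNormedType.Exports.

Local Open Scope classical_set_scope.
Local Open Scope ring_scope.

(* The library norm `|x| on 'rV[R]_n is the sup norm, not the Euclidean one. *)
Definition enorm (R : realType) (n : nat) (x : 'rV[R]_n) : R :=
  Num.sqrt (\sum_(i < n) x 0 i ^+ 2).

Definition at_infinity (R : realType) (n : nat) : set_system 'rV[R]_n :=
  filter_from setT (fun M : R => [set x | M < enorm x]).

Definition partial (R : realType) (n : nat) (i : 'I_n.+1) (f : 'rV[R]_n.+1 -> R) :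
    'rV[R]_n.+1 -> R :=
  fun x => 'D_(delta_mx 0 i) f x.

(* 'D_v f x is a junk value where the limit does not exist, so existence of the
   partial derivatives is required separately at every order. *)
Fixpoint is_Ck (R : realType) (n k : nat) (f : 'rV[R]_n.+1 -> R) : Prop :=
  continuous f /\
  if k is k'.+1 then
    forall i : 'I_n.+1,
      (forall x, derivable f x (delta_mx 0 i)) /\ is_Ck k' (partial i f)
  else True.

Definition laplacian (R : realType) (n : nat) (f : 'rV[R]_n.+1 -> R) :
    'rV[R]_n.+1 -> R :=
  fun x => \sum_(i < n.+1) partial i (partial i f) x.

(* Main.v *)
(** Put u = psi2 - psi1. Where u > 0, monotonicity gives Laplacian u >= 0, and
    u <= o(log |x|) at infinity. Fix a and m > max(u(a), 0), so that u < m on a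
    small disc |y - a| <= r. Outside this disc compare u with
    m + e ln(k |y - a|^2 - 1), where k = 2 / r^2: the logarithm vanishes on the
    circle, dominates ln |y| at infinity, and has Laplacian
    -4 k / (k |y - a|^2 - 1)^2 < 0, so the difference has no positive maximum.
    Letting e -> 0 and m -> max(u(a), 0) yields u(x) <= max(u(a), 0) for all a
    and x. Hence, if u is positive somewhere, it is a positive constant. *)
Require Import Defs.
From HB Require Import structures.
From mathcomp Require Import all_boot all_order all_algebra.
From mathcomp Require Import all_classical all_reals all_analysis.
From mathcomp Require Import ring lra.

Import Order.TTheory GRing.Theory Num.Theory.
Import numFieldNormedType.Exports.

Local Open Scope classical_set_scope.
Local Open Scope ring_scope.

(** * One-variable calculus *)

(** At the maximum [df c = 0]. If [d] were positive, [df] would be positive just to the right of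
    [c], and the mean value theorem would make [f (c + r)] exceed [f c]. *)
Lemma second_derivative_at_max (R : realType) (f df : R -> R) (c d : R) :
  (\forall t \near c, is_derive (t : R) 1 f (df t)) -> is_derive c 1 df d ->
  (\forall t \near c, f t <= f c) -> d <= 0.
Proof.
move=> fdf dfd fmax; rewrite leNgt; apply/negP => d_gt0.
have [e /= e_gt0 He] : exists2 e : R, 0 < e &
    forall t, `|c - t| < e -> is_derive t 1 f (df t) /\ f t <= f c.
  have [e e_gt0 He] := filterI fdf fmax.
  by exists e => // t te; exact: (He t te).
have df0 : df c = 0.
  have Hce t : t \in `]c - e, c + e[ -> `|c - t| < e.
    by rewrite in_itv /= ltr_norml => /andP[? ?]; apply/andP; split; lra.
  have /(@derive_val _ _ _ _ _ _ _) <- : is_derive c 1 f 0.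
    apply: (@derive1_at_max _ f (c - e) (c + e)) => [|t|| t].
    - lra.
    - by move=> /Hce/He[[]].
    - by rewrite in_itv /=; apply/andP; split; lra.
    - by move=> /Hce/He[].
  have [|H _] := He c; first by rewrite subrr normr0.
  by rewrite (@derive_val _ _ _ _ _ _ _ H).
have : (fun h : R => h^-1 *: ((df \o shift c) (h *: (1 : R)) - df c)) @ 0^' --> d.
  case: dfd => /= dc <-; exact: dc.
move=> /cvgr_gt/(_ 0 d_gt0) [e' /= e'_gt0 He'].
have [r r_gt0 /andP[re re']] : exists2 r : R, 0 < r & (r < e) && (r < e').
  exists (Num.min e e' / 2).
    by rewrite divr_gt0 // lt_min e_gt0.
  have : 0 < Num.min e e' by rewrite lt_min e_gt0.
  have : Num.min e e' <= e by rewrite ge_min lexx.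
  have : Num.min e e' <= e' by rewrite ge_min lexx orbT.
  by move=> *; apply/andP; split; lra.
have Hcr t : c <= t -> t <= c + r -> `|c - t| < e.
  by move=> ? ?; rewrite ltr_norml; apply/andP; split; lra.
have [|x||x] := @MVT _ f df c (c + r).
- lra.
- rewrite in_itv /= => /andP[cx xr].
  by case: (He x (Hcr x (ltW cx) (ltW xr))).
- apply: derivable_within_continuous => x; rewrite in_itv /= => /andP[cx xr].
  by case: (He x (Hcr x cx xr)) => [[]].
rewrite in_itv /= => /andP[cx xr].
have /= := He' (x - c); rewrite sub0r normrN gtr0_norm ?subr_gt0//.
have -> : (x - c < e') by lra.
have -> : x - c != 0 by rewrite subr_eq0 gt_eqF.
move=> /(_ isT isT); rewrite df0 subr0 [_ *: 1]mulr1 subrK => H E.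
have dfx : 0 < df x.
  by move: H; rewrite /GRing.scale /= pmulr_rgt0 // invr_gt0 subr_gt0.
have [|_] := He (c + r); first by apply: Hcr; lra.
have : 0 < df x * (c + r - c) by rewrite mulr_gt0 //; lra.
lra.
Qed.

Lemma is_derive_line (R : realType) (n : nat) (f : 'rV[R]_n -> R)
    (x v : 'rV[R]_n) (t : R) : derivable f (x + t *: v) v ->
  is_derive t 1 (fun s => f (x + s *: v)) ('D_v f (x + t *: v)).
Proof.
have E : (fun h : R => h^-1 *: (((fun s => f (x + s *: v)) \o shift t) (h *: (1 : R))
            - f (x + t *: v))) =
         (fun h : R => h^-1 *: ((f \o shift (x + t *: v)) (h *: v) - f (x + t *: v))).
  apply/funext => h /=; congr (_ *: (f _ - _)).
  by rewrite [_ *: 1]mulr1 scalerDl addrCA.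
by move=> dfx; split; rewrite /derivable /derive E.
Qed.

Lemma is_derive_transfer (R : realType) (f g : R -> R) (t df dg : R) :
  is_derive t 1 f df -> f =1 g -> df = dg -> is_derive t 1 g dg.
Proof. by move=> fdf /funext <- <-. Qed.

(** On the line through [x] in the direction of coordinate [i], the argument of the barrier's
    logarithm has this form: [s] is coordinate [i] of [x - a], and [b] is the square of the other
    coordinate. *)
Lemma is_derive_quadratic (R : realType) (k b s t : R) :
  is_derive t 1 (fun t => k * ((s + t) ^+ 2 + b) - 1) (2 * k * (s + t)).
Proof.
have ds := is_derive_shift t (1 : R) s.
have := is_deriveB (is_deriveZ k (is_deriveD (is_deriveM ds ds) (is_derive_cst b t 1)))
  (is_derive_cst (1 : R) t 1).
move=> /is_derive_transfer; apply => [y|]; rewrite ?fctE /= /GRing.scale /=; ring.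
Qed.

Lemma is_derive_log_quadratic (R : realType) (e k b s t : R) :
  0 < k * ((s + t) ^+ 2 + b) - 1 ->
  is_derive t 1 (fun t => e * ln (k * ((s + t) ^+ 2 + b) - 1))
    (e * (2 * k * (s + t) / (k * ((s + t) ^+ 2 + b) - 1))).
Proof.
move=> D_gt0.
have := is_deriveZ e (is_derive1_comp (g := fun t => k * ((s + t) ^+ 2 + b) - 1)
  (is_derive1_ln D_gt0) (is_derive_quadratic R k b s t)).
by move=> /is_derive_transfer; apply => //; rewrite /GRing.scale /=; ring.
Qed.

Lemma is_derive_log_quadratic2 (R : realType) (e k b s : R)
    (D := k * (s ^+ 2 + b) - 1) : 0 < D ->
  is_derive (0 : R) 1 (fun t => e * (2 * k * (s + t) / (k * ((s + t) ^+ 2 + b) - 1)))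
    (e * (2 * k / D - (2 * k * s) ^+ 2 / D ^+ 2)).
Proof.
move=> D_gt0.
have D0 : k * ((s + 0) ^+ 2 + b) - 1 != 0 by rewrite addr0 gt_eqF.
have := is_deriveZ e (is_deriveM (is_deriveZ (2 * k) (is_derive_shift (0 : R) 1 s))
  (is_deriveV (f := fun t => k * ((s + t) ^+ 2 + b) - 1) D0
    (is_derive_quadratic R k b s 0))).
move=> /is_derive_transfer; apply => [y|].
  by rewrite ?fctE /= /GRing.scale /= [y + s]addrC.
rewrite /= /GRing.scale /= addr0 add0r -/D; field.
by rewrite gt_eqF.
Qed.

(** * Partial derivatives and the Laplacian *)

(** The one-variable test is applied to [u] on the coordinate line minus [g]. A barrier enters only
    through its restriction [g], so one-variable rules suffice to differentiate it. *)
Lemma partial2_le_at_max (R : realType) (n : nat) (u : 'rV[R]_n.+1 -> R)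
    (x : 'rV[R]_n.+1) (i : 'I_n.+1) (g dg : R -> R) (d : R) :
  is_Ck 2 u ->
  (\forall t \near 0, is_derive (t : R) 1 g (dg t)) -> is_derive (0 : R) 1 dg d ->
  (\forall t \near 0, u (x + t *: delta_mx 0 i) - g t <= u x - g 0) ->
  partial i (partial i u) x <= d.
Proof.
move=> [_ /(_ i) [du [_ /(_ i) [ddu _]]]] gdg dgd umax.
rewrite -subr_le0.
apply: (@second_derivative_at_max _ (fun t => u (x + t *: delta_mx 0 i) - g t)
  (fun t => partial i u (x + t *: delta_mx 0 i) - dg t) 0).
- near=> t.
  have dt : is_derive t 1 g (dg t) by near: t.
  by have := is_deriveB (is_derive_line _ _ _ _ _ _ (du (x + t *: delta_mx 0 i))) dt.
- have := is_deriveB (is_derive_line _ _ _ _ _ _ (ddu (x + 0 *: delta_mx 0 i))) dgd.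
  by rewrite scale0r addr0.
- by rewrite scale0r addr0.
Unshelve. all: by end_near. Qed.

Lemma is_CkB (R : realType) (n k : nat) (f g : 'rV[R]_n.+1 -> R) :
  is_Ck k f -> is_Ck k g -> is_Ck k (f - g).
Proof.
elim: k f g => [|k IHk] f g [cf Hf] [cg Hg]; split.
- by move=> x; apply: continuousB; [exact: cf|exact: cg].
- by [].
- by move=> x; apply: continuousB; [exact: cf|exact: cg].
- move=> i; have [df Cf] := Hf i; have [dg Cg] := Hg i; split.
    by move=> x; exact: derivableB.
  have -> : partial i (f - g) = partial i f - partial i g.
    by apply/funext => x; rewrite /partial deriveB.
  exact: IHk.
Qed.

Lemma laplacianB (R : realType) (n : nat) (f g : 'rV[R]_n.+1 -> R) :
  is_Ck 2 f -> is_Ck 2 g ->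
  forall x, laplacian (f - g) x = laplacian f x - laplacian g x.
Proof.
move=> [_ Hf] [_ Hg] x; rewrite /laplacian -sumrB; apply: eq_bigr => i _.
have [df [_ /(_ i) [ddf _]]] := Hf i; have [dg [_ /(_ i) [ddg _]]] := Hg i.
have -> : partial i (f - g) = partial i f - partial i g.
  by apply/funext => y; rewrite /partial deriveB.
by rewrite /partial deriveB.
Qed.

Lemma laplacian_cst (R : realType) (n : nat) (c : R) (x : 'rV[R]_n.+1) :
  laplacian (cst c) x = 0.
Proof.
rewrite /laplacian big1 // => i _.
have -> : partial i (cst c) = cst 0 by apply/funext => y; exact: derive_cst.
exact: derive_cst.
Qed.

(** * The Euclidean norm *)

Lemma enorm_ge0 (R : realType) (n : nat) (x : 'rV[R]_n) : 0 <= enorm x.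
Proof. exact: sqrtr_ge0. Qed.

Lemma sqr_enorm (R : realType) (n : nat) (x : 'rV[R]_n) :
  enorm x ^+ 2 = \sum_(i < n) x 0 i ^+ 2.
Proof. by rewrite sqr_sqrtr // sumr_ge0 // => i _; exact: sqr_ge0. Qed.

(** Passes from Euclidean bounds to the sup norm, in which neighbourhoods and boundedness are
    expressed. *)
Lemma norm_le_enorm (R : realType) (n : nat) (x : 'rV[R]_n) : `|x| <= enorm x.
Proof.
rewrite /Num.norm /= mx_normrE.
apply: (big_ind (fun y => y <= enorm x)) => [|y z yx zx|[i j] _ /=].
- exact: enorm_ge0.
- by rewrite ge_max yx.
- rewrite (ord1 i) -(@ler_pXn2r _ 2) ?nnegrE ?enorm_ge0 ?normr_ge0 // sqr_enorm.
  rewrite real_normK ?num_real // (bigD1 j) //= lerDl sumr_ge0 // => k _.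
  exact: sqr_ge0.
Qed.

Lemma continuous_enorm (R : realType) (n : nat) : continuous (@enorm R n).
Proof.
move=> x; rewrite /enorm.
apply: (@continuous_comp _ _ _ (fun x : 'rV[R]_n => \sum_(i < n) x 0 i ^+ 2) Num.sqrt);
  last exact: sqrt_continuous.
apply: continuous_big => [|i _ y]; first exact: add_continuous.
apply: (@continuous_comp _ _ _ (fun M : 'rV[R]_n => M 0 i) (fun t => t ^+ 2)).
  exact: coord_continuous.
exact: exprn_continuous.
Qed.

(** In each coordinate the difference of the two sides is [(p - 2 q)^2 / 2]. *)
Lemma enorm_sub_ge (R : realType) (n : nat) (x y : 'rV[R]_n) :
  enorm x ^+ 2 / 2 - enorm y ^+ 2 <= enorm (x - y) ^+ 2.
Proof.
rewrite !sqr_enorm mulr_suml -sumrB; apply: ler_sum => i _; rewrite !mxE.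
have := sqr_ge0 (x 0 i - 2 * y 0 i); nra.
Qed.

Lemma near_line (R : realType) (n : nat) (x v : 'rV[R]_n) (P : set 'rV[R]_n) :
  (\forall y \near x, P y) -> \forall t \near (0 : R), P (x + t *: v).
Proof.
have c : (fun t : R => x + t *: v) @ 0 --> x.
  rewrite -[X in _ --> X]addr0 -[in X in _ --> X](scale0r v).
  apply: cvgD; first exact: cvg_cst.
  exact: scalel_continuous.
exact: c.
Qed.

(** * Comparison with the logarithmic barrier *)

(** The two second derivatives of the barrier add up to [e (4 k / D - 4 k (D + 1) / D^2)], because
    [k |x - a|^2 = D + 1]. *)
Lemma laplacian_at_max_sub_log (R : realType) (u : 'rV[R]_2 -> R) (a x : 'rV[R]_2)
    (e k : R) (D := fun y => k * enorm (y - a) ^+ 2 - 1) :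
  is_Ck 2 u -> 0 < D x ->
  (\forall y \near x, 0 < D y /\ u y - e * ln (D y) <= u x - e * ln (D x)) ->
  laplacian u x <= - (4 * e * k / D x ^+ 2).
Proof.
move=> Cu Dx_gt0 umax.
(* [rev_ord i] is the other index of ['I_2], so one computation serves both directions. *)
have sum2 (f : 'I_2 -> R) (i : 'I_2) : \sum_(j < 2) f j = f i + f (rev_ord i).
  rewrite big_ord_recl big_ord1.
  by case: i => [[|[|//]]] ?; [|rewrite addrC]; congr (f _ + f _); apply/val_inj.
have DE i t : D (x + t *: delta_mx 0 i) =
    k * (((x - a) 0 i + t) ^+ 2 + (x - a) 0 (rev_ord i) ^+ 2) - 1.
  rewrite /D sqr_enorm (sum2 _ i) !mxE !eqxx /=.
  have -> : (rev_ord i == i) = false by case: i => [[|[|//]]].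
  by rewrite /= mulr1 mulr0 addr0 addrAC.
have DE0 i : D x = k * ((x - a) 0 i ^+ 2 + (x - a) 0 (rev_ord i) ^+ 2) - 1.
  by rewrite -{1}[x]addr0 -(scale0r (delta_mx 0 i)) DE addr0.
have step i : partial i (partial i u) x <=
    e * (2 * k / D x - (2 * k * (x - a) 0 i) ^+ 2 / D x ^+ 2).
  apply: (@partial2_le_at_max _ _ u x i (fun t => e * ln (D (x + t *: delta_mx 0 i)))) => //.
  - have := near_line _ _ _ (delta_mx 0 i) _ umax; apply: filterS => t [Dt _].
    have := Dt; rewrite DE => /(is_derive_log_quadratic R e)/is_derive_transfer; apply => //.
    by move=> t'; rewrite DE.
  - by rewrite (DE0 i); apply: is_derive_log_quadratic2; rewrite -DE0.
  - have := near_line _ _ _ (delta_mx 0 i) _ umax; apply: filterS => t [_].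
    by rewrite scale0r addr0.
have -> : laplacian u x = _ := sum2 _ 0.
apply: le_trans (lerD (step _) (step _)) _; rewrite le_eqVlt; apply/orP; left; apply/eqP.
have : D x != 0 by rewrite gt_eqF.
rewrite (DE0 0); move: ((x - a) 0 0) ((x - a) 0 _) => p q Dpq.
by field.
Qed.

Lemma le_max_of_sublog_growth (R : realType) (u : 'rV[R]_2 -> R) :
  is_Ck 2 u -> (forall x, 0 < u x -> 0 <= laplacian u x) ->
  (forall e, 0 < e -> exists M, forall x, M < enorm x -> u x <= e * ln (enorm x)) ->
  forall a x, u x <= Num.max (u a) 0.
Proof.
move=> Cu usub ulog a x; rewrite leNgt gt_max; apply/negP => /andP[uax ux_gt0].
have cu : continuous u by case: Cu.
have [m m_gt0 /andP[uam mux]] : exists2 m, 0 < m & (u a < m) && (m < u x).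
  exists ((Num.max (u a) 0 + u x) / 2).
    by rewrite divr_gt0 // ltr_wpDl // le_max lexx orbT.
  have : u a <= Num.max (u a) 0 by rewrite le_max lexx.
  have : Num.max (u a) 0 < u x by rewrite gt_max uax.
  by move=> *; apply/andP; split; lra.
have [r r_gt0 ur] : exists2 r : R, 0 < r & forall y, enorm (y - a) <= r -> u y < m.
  have : \forall y \near a, u y < m by exact: cvgr_lt (cu a) _ uam.
  move=> /nbhs_normP[r /= r_gt0 Hr]; exists (r / 2); first by rewrite divr_gt0.
  move=> y yr; apply: Hr; rewrite /ball_ /= distrC.
  by apply: (le_lt_trans (norm_le_enorm _ _ (y - a))); lra.
have [k k_gt0 kr] : exists2 k, 0 < k & k * r ^+ 2 = 2.
  by exists (2 / r ^+ 2); rewrite ?divr_gt0 ?mulfVK ?gt_eqF ?exprn_gt0.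
pose D y := k * enorm (y - a) ^+ 2 - 1.
have D_ge1 y : r <= enorm (y - a) -> 1 <= D y.
  move=> ry; have : k * r ^+ 2 <= k * enorm (y - a) ^+ 2.
    by rewrite ler_pM2l // ler_pXn2r // ?nnegrE ?enorm_ge0 // ltW.
  by rewrite kr /D; lra.
have rx : r <= enorm (x - a).
  by rewrite leNgt; apply/negP => /ltW/ur; rewrite ltNge (ltW mux).
have lnDx_ge0 : 0 <= ln (D x) by rewrite ln_ge0 // D_ge1.
(* This [e] costs at most half of the gap [u x - m]; the [+ 1] guards against [ln (D x) = 0]. *)
have [e e_gt0 mvx] : exists2 e, 0 < e & m < u x - e * ln (D x).
  exists ((u x - m) / 2 / (ln (D x) + 1)).
    by rewrite !divr_gt0 ?subr_gt0 // ltr_wpDl.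
  have : (u x - m) / 2 / (ln (D x) + 1) * ln (D x) <= (u x - m) / 2.
    rewrite -mulrA ler_piMr //; first by lra.
    by rewrite mulrC ler_pdivrMr ?mul1r; lra.
  by lra.
have [M HM] := ulog e e_gt0.
(* For [|y| > N], both [|y|] and [k |a|^2 + 1] are at most [k |y|^2 / 4]. Hence
   [D y >= k |y|^2 / 2 - k |a|^2 - 1 >= |y|], and the growth bound on [u] passes to [ln (D y)]. *)
pose N := `|M| + 2 * enorm a + 4 / k + 1.
have HN y : N < enorm y -> u y <= e * ln (D y).
  rewrite /N => Ny; have [M_le M_ge0] := (ler_norm M, normr_ge0 M).
  have c_gt0 : 0 < 4 / k by rewrite divr_gt0.
  have [a_ge0 y_ge0] := (enorm_ge0 _ _ a, enorm_ge0 _ _ y).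
  apply: le_trans (HM y _) _; first by lra.
  suff yD : enorm y <= D y by rewrite ler_pM2l // ler_ln ?posrE //; lra.
  have ky : 4 <= k * enorm y.
    by rewrite mulrC -ler_pdivrMr //; lra.
  have ky2 : 4 * enorm y <= k * enorm y ^+ 2 by rewrite expr2 mulrA ler_wpM2r.
  have ka2 : k * (4 * enorm a ^+ 2 + 4 / k) <= k * enorm y ^+ 2.
    rewrite ler_pM2l //.
    apply: (@le_trans _ _ ((2 * enorm a + (4 / k + 1)) ^+ 2)); first by nra.
    by rewrite ler_pXn2r ?nnegrE //; lra.
  rewrite mulrDr mulrCA [k * (4 / k)]mulrC divfK ?gt_eqF // in ka2.
  have : k * (enorm y ^+ 2 / 2 - enorm a ^+ 2) <= k * enorm (y - a) ^+ 2.
    by rewrite ler_pM2l // enorm_sub_ge.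
  by rewrite /D; lra.
pose v y := u y - e * ln (D y).
pose S := [set y : 'rV[R]_2 | r <= enorm (y - a)] `&` [set y | enorm y <= N].
have ca : continuous (fun y : 'rV[R]_2 => enorm (y - a)).
  move=> y; have yB : (fun z : 'rV[R]_2 => z - a) @ y --> y - a.
    by apply: (@cvgB _ _ _ (nbhs y) _ (fun z : 'rV[R]_2 => z) (fun=> a) y a);
      [exact: cvg_id|exact: cvg_cst].
  exact: cvg_comp yB (continuous_enorm _ _ (y - a)).
have Sx : S x.
  split => //=; rewrite leNgt; apply/negP => /HN; lra.
have cS : compact S.
  apply: bounded_closed_compact.
    exists N; split; first exact: num_real.
    by move=> M' NM' y [_ /= yN]; apply: (le_trans (norm_le_enorm _ _ y)); lra.
  apply: closedI.
    apply: (@closed_comp _ _ _ [set t | r <= t]); last exact: closed_ge.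
    by move=> y _; exact: ca.
  apply: (@closed_comp _ _ _ [set t | t <= N]); last exact: closed_le.
  by move=> y _; exact: continuous_enorm.
have cv : {within S, continuous v}.
  apply: continuous_in_subspaceT => y /set_mem[/= /D_ge1 Dy _].
  have cq : (fun z : 'rV[R]_2 => enorm (z - a) ^+ 2) @ y --> enorm (y - a) ^+ 2.
    exact: cvg_comp (ca y) (@exprn_continuous _ 2 _).
  have cD : D @ y --> D y.
    apply: (@cvgB _ R^o _ (nbhs y)); last exact: cvg_cst.
    by apply: cvgM => //; exact: cvg_cst.
  have clnD : (fun z => ln (D z)) @ y --> ln (D y).
    by apply: cvg_comp cD _; apply: continuous_ln; exact: lt_le_trans Dy.
  apply: (@cvgB _ R^o _ (nbhs y)); first exact: cu.
  by apply: cvgM => //; exact: cvg_cst.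
have [x0 /set_mem[/= rx0 _] vmax] := EVT_max_rV (ex_intro _ x Sx) cS cv.
have mv0 : m < v x0 by apply: lt_le_trans mvx _; apply: vmax; exact/mem_set.
(* Beyond radius [N], [v <= 0 < m < v x0], so the maximum over the compact set [S] is one over the
   whole exterior of the disc. *)
have vmax' y : r <= enorm (y - a) -> v y <= v x0.
  move=> ry; have [yN|/HN Ny] := leP (enorm y) N; first exact/vmax/mem_set.
  by rewrite /v in mv0 *; lra.
(* On the circle [D = 1], so [v = u < m] there. Thus [x0] is interior to the exterior region and a
   local maximum of [v]. *)
have rx0' : r < enorm (x0 - a).
  rewrite lt_neqAle rx0 andbT; apply/eqP => E.
  have /ur : enorm (x0 - a) <= r by rewrite E.
  by move: mv0; rewrite /v /D -E kr (_ : 2 - 1 = 1) ?ln1; lra.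
have D0 := D_ge1 _ rx0; have D0_gt0 := lt_le_trans ltr01 D0.
have lnD0 : 0 <= ln (D x0) by exact: ln_ge0.
have Lu_le : laplacian u x0 <= - (4 * e * k / D x0 ^+ 2).
  apply: laplacian_at_max_sub_log => //.
  have : \forall y \near x0, r < enorm (y - a) by exact: cvgr_gt (ca x0) _ rx0'.
  apply: filterS => y ry; split; last by apply: vmax'; exact: ltW.
  by apply: lt_le_trans (D_ge1 _ (ltW ry)).
(* Positivity of [u x0 = v x0 + e ln (D x0)] makes the Laplacian of [u] nonnegative at [x0], against
   the strictly negative bound [Lu_le]. *)
have ux0_gt0 : 0 < u x0.
  by have := mulr_ge0 (ltW e_gt0) lnD0; rewrite /v in mv0; lra.
have := le_trans (usub _ ux0_gt0) Lu_le.
by rewrite oppr_ge0 leNgt divr_gt0 ?exprn_gt0 ?mulr_gt0.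
Qed.

(** * The dichotomy for [psi2 - psi1] *)

Theorem theorem1p3 (R : realType) (F1 F2 : 'rV[R]_2 * R -> R)
    (psi1 psi2 : 'rV[R]_2 -> R)
    (cF1 : continuous F1) (cF2 : continuous F2)
    (F1_ge0 : forall z, 0 <= F1 z) (F2_ge0 : forall z, 0 <= F2 z)
    (F12 : forall (x : 'rV[R]_2) (r1 r2 : R), r1 <= r2 -> F1 (x, r1) <= F2 (x, r2))
    (C2psi1 : is_Ck 2 psi1) (C2psi2 : is_Ck 2 psi2)
    (ineq : forall x, - laplacian psi2 x + F2 (x, psi2 x)
                      <= - laplacian psi1 x + F1 (x, psi1 x))
    (growth : (0 <= limf_einf (fun x : 'rV[R]_2 =>
                       ((psi1 x - psi2 x) / ln (enorm x))%:E)
                     (@at_infinity R 2))%E) :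
  (forall x, psi2 x <= psi1 x) \/
  [/\ forall x, psi1 x < psi2 x,
      exists c : R, forall x, psi2 x - psi1 x = c
    & forall x, F1 (x, psi1 x) = F2 (x, psi2 x)].
Proof.
pose u := psi2 - psi1.
have Cu : is_Ck 2 u by exact: is_CkB.
have Lu x : laplacian u x = laplacian psi2 x - laplacian psi1 x by exact: laplacianB.
have usub x : 0 < u x -> 0 <= laplacian u x.
  rewrite /u [(_ - _) x]/(psi2 x - psi1 x) subr_gt0 => /ltW/F12-/(_ x).
  by rewrite Lu; have := ineq x; lra.
have ulog e : 0 < e -> exists M, forall x, M < enorm x -> u x <= e * ln (enorm x).
  move=> e_gt0; have growth' := growth; rewrite limf_einfE in growth'.
  have e_lt0 : ((- e)%:E < 0)%E by rewrite lte_fin oppr_lt0.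
  (* The lower limit is a supremum of infima over sets of the filter; since it exceeds [- e], so
     does one of these infima. *)
  have [_ [A [M _ AM] <-] eA] := ereal_sup_gt (lt_le_trans e_lt0 growth').
  (* The bound [1] makes [ln (enorm x)] positive, so the quotient can be cleared. *)
  exists (Num.max M 1) => x; rewrite gt_max => /andP[Mx x_gt1].
  have : ((- e)%:E < ((psi1 x - psi2 x) / ln (enorm x))%:E)%E.
    apply: lt_le_trans eA _.
    by apply: ereal_inf_lbound; exists x => //; exact: AM.
  rewrite lte_fin ltr_pdivlMr ?ln_gt0 //.
  have -> : u x = - (psi1 x - psi2 x) by rewrite opprB.
  by rewrite mulNr => /ltW; rewrite lerNl.
have umax := le_max_of_sublog_growth _ _ Cu usub ulog.
have [psi21|/existsNP[x0 /negP]] := pselect (forall x, psi2 x <= psi1 x); first by left.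
rewrite -ltNge -subr_gt0 -[psi2 x0 - _]/(u x0) => ux0; right.
(* Here [x] is the centre: [0 < u x0 <= max (u x) 0] forces [u x > 0]. The bound then reads
   [u y <= u x] for all [x] and [y], so [u] is constant. *)
have u_gt0 x : 0 < u x.
  by have := lt_le_trans ux0 (umax x x0); rewrite lt_max ltxx orbF.
have u_le x y : u y <= u x by have := umax x y; rewrite (max_l (ltW (u_gt0 x))).
have uE x : u x = u x0 by apply/eqP; rewrite eq_le !u_le.
split.
- by move=> x; rewrite -subr_gt0; exact: u_gt0.
- by exists (u x0) => x; exact: uE.
- move=> x; apply/eqP; rewrite eq_le F12 /=; last first.
    by rewrite -subr_ge0; exact: ltW (u_gt0 x).
  (* With equal Laplacians, [ineq] reduces to [F2 <= F1] along the two functions, the converse of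
     [F12]. *)
  have : laplacian u x = 0.
    by rewrite (_ : u = cst (u x0)) ?laplacian_cst //; apply/funext => y; exact: uE.
  by rewrite Lu; have := ineq x; lra.
Qed.
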